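(* Let $K$ be a field, $V$ a finite-dimensional $K$-vector space and $x \colon V \to V$ an $f$-primary endomorphism of $V$ for some monic irreducible polynomial $f \in K[T]$ of inseparability degree $q \in \mathbb{N}_{>0}$. Then $x$ admits a Jordan-Chevalley decomposition if and only if $$\operatorname{inv}_{(i-1)q+1} x \;\leq\; 1 + \operatorname{inv}_{iq} x$$ for all integers $i > 0$.
   Context: Natural numbers $\mathbb{N}$ include $0$. An endomorphism $x$ of a finite-dimensional $K$-vector space $V$ is called $f$-primary, for a monic irreducible $f \in K[T]$, if its minimal polynomial is a power of $f$. An endomorphism $s$ of $V$ is semisimple if letting the variable $S$ act on $V$ through $s$ turns $V$ into a semisimple $K[S]$-module; equivalently, the minimal polynomial of $s$ over $K$ is square-free. (This is not required to persist after field extension.) A Jordan-Chevalley decomposition of $x$ is a decomposition $x = s + n$ with $s, n \in \operatorname{End}_K(V)$ such that $s \circ n = n \circ s$, $s$ is semisimple and $n$ is nilpotent. The inseparability degree $q$ of $f$ is the multiplicity of each root of $f$ in an algebraic closure of $K$ (so $q = 1$ if and only if $f$ is separable; otherwise $q$ is a power of the characteristic of $K$). If $x$ is $f$-primary, its invariant factors (the polynomials $g_1, g_2, \dotsc$ with $g_{i+1} \mid g_i$ occurring in the rational/Frobenius normal form, $g_1$ being the minimal polynomial) are all powers of $f$. One writes $\operatorname{inv} x = (\operatorname{inv}_1 x, \operatorname{inv}_2 x, \dotsc)$ for the decreasing sequence of exponents, indexed from $1$ and extended by zeros; i.e. $V \cong \bigoplus_{i \geq 1} K[T]/(f^{\operatorname{inv}_i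 x})$ as $K[T]$-modules with $T$ acting on $V$ through $x$ and $\operatorname{inv}_1 x \geq \operatorname{inv}_2 x \geq \dotsb$. It is a partition of $m = \dim_K V/\deg f$. *)

(* Defs.v *)
From mathcomp Require Export all_boot all_order all_algebra.
Set Implicit Arguments.
Unset Strict Implicit.
Unset Printing Implicit Defensive.
Import GRing.Theory.
Local Open Scope ring_scope.

Section Endomorphisms.

Variables (K : fieldType) (V : vectType K).
Implicit Types (x s n : 'End(V)) (f g p : {poly K}) (U W : {vspace V}).

(* 'End(V) carries no canonical ring structure, because V may be zero; hence
   powers and polynomial evaluation are written out. *)
Definition end_exp x k : 'End(V) := iter k (fun y => (x \o y)%VF) \1%VF.

Definition end_horner p x : 'End(V) := \sum_(i < size p) p`_i *: end_exp x i.

Definition is_minpoly x g : Prop :=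
  [/\ g \is monic, end_horner g x = 0
    & forall p, end_horner p x = 0 -> g %| p].

Definition primary f x : Prop := exists k : nat, is_minpoly x (f ^+ k).

Definition nilpotent_end n : Prop := exists k : nat, end_exp n k = 0.

(* The submodules of V, seen as a K[S]-module with S acting through s, are the
   s-stable subspaces. *)
Definition stable_sub s U : Prop := (s @: U <= U)%VS.

Definition simple_sub s U : Prop :=
  [/\ stable_sub s U, U != 0%VS
    & forall W, stable_sub s W -> (W <= U)%VS -> W = 0%VS \/ W = U].

(* The K[S]-module V is a direct sum of simple submodules; the family is empty
   when V = 0. *)
Definition semisimple_end s : Prop :=
  exists (r : nat) (U : 'I_r -> {vspace V}),
    [/\ forall i, simple_sub s (U i),
        (\sum_(i < r) U i)%VS = fullv
      & directv (\sum_(i < r) U i)].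

Definition has_Jordan_Chevalley x : Prop :=
  exists s n : 'End(V),
    [/\ x = s + n, (s \o n)%VF = (n \o s)%VF,
        semisimple_end s & nilpotent_end n].

(* inv : nat -> nat is indexed from 1 (inv 0 is irrelevant), and r is the
   number of its nonzero terms. As a K[T]-module with T acting through x, V is
   isomorphic to the direct sum of the K[T]/(f ^ inv i) for 1 <= i <= r, the
   isomorphism being given by its components phi. The zero quotients
   (inv i = 0) have to be left out: {poly %/ 1} is by convention K[X]/(X). *)
Definition is_inv f x (inv : nat -> nat) : Prop :=
  exists r : nat,
    [/\ forall i, (0 < i)%N -> (inv i.+1 <= inv i)%N,
        forall i, (0 < i)%N -> (0 < inv i)%N = (i <= r)%N
      & exists phi : forall i : 'I_r, {linear V -> {poly %/ f ^+ inv i.+1}},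
          (forall i v, phi i (x v) = 'qX * phi i v) /\
          bijective (fun v : V =>
            [ffun i : 'I_r => phi i v]
              : {dffun forall i : 'I_r, {poly %/ f ^+ inv i.+1}})].

End Endomorphisms.

Section InseparabilityDegree.

Variables (K : fieldType) (Kbar : closedFieldType).
Variable iota : {rmorphism K -> Kbar}.

Definition is_algebraic_closure : Prop := forall z, algebraicOver iota z.

(* This determines q when f is not constant, as f then has a root in Kbar. *)
Definition is_insep_degree (f : {poly K}) (q : nat) : Prop :=
  forall z, root (map_poly iota f) z -> mup z (map_poly iota f) = q.

End InseparabilityDegree.

(* Main.v *)
From HB Require Import structures.
Require Import Defs.
From mathcomp Require Import all_boot all_order all_algebra.
From mathcomp Require Import ring zify.
Import GRing.Theory.
Local Open Scope ring_scope.
Set Implicit Arguments.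
Unset Strict Implicit.
Unset Printing Implicit Defensive.

(** Write f = g(T^q) with g separable and q = 1 or a power of the characteristic,
    so that raising commuting endomorphisms to the power q is additive.

    If x = s + n is a Jordan-Chevalley decomposition, then f(s) = 0, and f(x) is
    n^q times an injective endomorphism, by Taylor expansion of g at s^q. Hence
    ker f(x)^j = ker n^(qj). The kernels of the powers of n have dimensions that
    are concave in the exponent and divisible by deg f, because every s-stable
    subspace is a sum of simple ones of dimension deg f; the number of invariants
    exceeding j is (dim ker n^(q(j+1)) - dim ker n^(qj)) / deg f, and comparing it
    for two consecutive values of j gives the inequalities.

    Conversely, Hensel's lemma for g yields a multiple y of f such that
    g(x^q - y(x)) = 0. Let e_0, e_1, ... generate the cyclic summands of V, and let
    n be the K[x]-linear map shifting e_l to e_(l+1) inside each block of q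
    consecutive indices, and the last generator of a block to y(x) times the first
    one. The inequalities say exactly that n is well defined. As n^q = y(x), the map
    s = x - n satisfies f(s) = g(s^q) = g(x^q - y(x)) = 0. *)

(** * Separable part and Hensel lifting *)

(** Arbitrary commutative coefficients are allowed because the formula is applied over polynomial
    rings, to reach composition and commuting endomorphisms. *)
Lemma horner_taylor2 (R : comNzRingType) (p : {poly R}) (x h : R) :
  exists w, p.[x + h] = p.[x] + h * (p^`().[x] + h * w).
Proof.
have cxh : GRing.comm x h by apply: mulrC.
have := nderiv_taylor_wide cxh (leqW (leqnSn (size p))).
rewrite !big_ord_recl /= expr0 mulr1 nderivn0 expr1 nderivn1 => ->.
exists (\sum_(i < size p) p^`N(i.+2).[x] * h ^+ i).
rewrite mulrDr mulrA -expr2 mulr_sumr [X in _ + (X + _)]mulrC; congr (_ + (_ + _)).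
by apply: eq_bigr => i _; rewrite [RHS]mulrCA -exprD.
Qed.

Lemma comp_poly_taylor2 (R : comNzRingType) (p a b : {poly R}) :
  exists w, p \Po (a + b) = p \Po a + b * (p^`() \Po a + b * w).
Proof.
have [w Ew] := horner_taylor2 p^:P a b.
by exists w; rewrite /comp_poly Ew deriv_map.
Qed.

(** Newton's iteration for g(a) = 0, started at a = X^q, where g(X^q) = f vanishes modulo f. The
    derivative g'(X^q) is invertible modulo f since g and g' are coprime. *)
Lemma hensel_root (K : fieldType) (f g : {poly K}) q k : coprimep g g^`() ->
  f = g \Po 'X^q -> exists y, f %| y /\ f ^+ k %| g \Po ('X^q - y).
Proof.
move=> /Bezout_eq1_coprimepP[[u v] /= Euv] Ef.
(* Exponents 0 and 1 both start from y = 0. From f^(k+1) on, the correction is divisible by f and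
   its square by f^(k+2). *)
elim: k => [|[|k] [y [fy]]]; first by exists 0; rewrite dvdp0 expr0 dvd1p.
  by exists 0; rewrite dvdp0 subr0 -Ef expr1 dvdpp.
set a := 'X^q - y => /dvdpP[c Ec].
(* Newton's step: [v \Po 'X^q] inverts [g^`() \Po 'X^q] modulo [f]. *)
pose b := - (f ^+ k.+1 * (c * (v \Po 'X^q))).
(* The first expansion moves the approximate root from [a] to [a + b]; the second shows that g'(a)
   differs from g'(X^q) by a multiple of [y], hence of [f]. *)
have [w Ew] := comp_poly_taylor2 g a b.
have [w' Ew'] := comp_poly_taylor2 g^`() 'X^q (- y).
have fk : f ^+ k.+1 = f * f ^+ k by rewrite exprS.
case/dvdpP: fy => y' Ey.
exists (y - b); split.
  rewrite Ey /b fk opprK; apply: dvdp_add; first by apply: dvdp_mull.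
  by rewrite -mulrA dvdp_mulr.
have -> : 'X^q - (y - b) = a + b by rewrite /a; ring.
rewrite Ew Ec.
have Ev : (v \Po 'X^q) * (g^`() \Po 'X^q) = 1 - (u \Po 'X^q) * f.
  have := congr1 (fun P => P \Po 'X^q) Euv.
  by rewrite comp_polyD !comp_polyM -Ef comp_polyC polyC1 => <-; ring.
set G := g^`() \Po a in Ew *; rewrite -[g^`() \Po a]/G -/a in Ew'.
set V := v \Po 'X^q in Ev *; set U := u \Po 'X^q in Ev.
set z := (g^`()^`() \Po 'X^q + - y * w') in Ew'.
have -> : c * f ^+ k.+1 + b * (G + b * w) =
    f ^+ k.+2 * (c * (U + V * y' * z) + f ^+ k * (c * V) * (c * V) * w).
  have -> : G = (g^`() \Po 'X^q) + - y * z by rewrite -Ew'.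
  have -> : c * f ^+ k.+1 + b * (g^`() \Po 'X^q + - y * z + b * w) =
     c * f ^+ k.+1 * (1 - V * (g^`() \Po 'X^q)) + c * f ^+ k.+1 * V * y * z
       + b * b * w by rewrite /b; ring.
  by rewrite Ev /b Ey !exprS; ring.
exact: dvdp_mulr.
Qed.

Section Inseparability.

Variables (K : fieldType) (Kbar : closedFieldType) (iota : {rmorphism K -> Kbar}).

(** A vanishing derivative means i f_i = 0 for all i: the leading term forces a positive
    characteristic p, and only exponents divisible by p survive. *)
Lemma deriv0_comp (f : {poly K}) : (1 < size f)%N -> f^`() = 0 ->
  exists p f1, p \in [pchar K] /\ f = f1 \Po 'X^p.
Proof.
move=> sz_f df0.
have coef0 i : f`_i.+1 *+ i.+1 = 0 by rewrite -coef_deriv df0 coef0.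
have f_neq0 : f != 0 by rewrite -size_poly_gt0; apply: leq_trans sz_f.
have Ed : (size f).-1 = (size f).-2.+1 by case: (size f) sz_f => [|[|]].
have [p pK] : exists p, p \in [pchar K].
  apply: (@natf0_pchar K (size f).-1); first by rewrite Ed.
  have /eqP := coef0 (size f).-2.
  rewrite -Ed -[_ *+ _]mulr_natr mulf_eq0 -lead_coefE.
  by rewrite lead_coef_eq0 (negPf f_neq0).
have p_gt0 := prime_gt0 (pcharf_prime pK).
exists p, (\poly_(i < size f) f`_(i * p)); split=> //.
apply/polyP => i; rewrite coef_comp_poly_Xn // coef_poly.
case: ifP => [pi|npi].
  rewrite divnK //; case: ltnP => // le; rewrite nth_default //.
  by apply: leq_trans le (leq_div _ _).
case: i npi => [|i npi]; first by rewrite dvdn0.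
have /eqP := coef0 i; rewrite -[_ *+ _]mulr_natr mulf_eq0 => /orP[/eqP->//|].
by rewrite -(dvdn_pcharf pK) npi.
Qed.

Lemma size_comp_Xn (f : {poly K}) p : (0 < p)%N -> f != 0 ->
  size (f \Po 'X^p) = ((size f).-1 * p).+1.
Proof.
move=> p_gt0 f_neq0; rewrite -[LHS]prednK.
  by rewrite size_comp_poly size_polyXn.
by rewrite size_poly_gt0 comp_poly_eq0 // size_polyXn.
Qed.

Lemma irreducible_comp_Xn (f : {poly K}) p : (0 < p)%N ->
  irreducible_poly (f \Po 'X^p) -> irreducible_poly f.
Proof.
move=> p_gt0 [sz irr].
have f_neq0 : f != 0 by apply: contraTneq sz => ->; rewrite comp_poly0 size_poly0.
have Ef := size_comp_Xn p_gt0 f_neq0.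
split=> [|h sz_h hf]; first by move: sz; rewrite Ef; case: (size f) => [|[]].
have h_neq0 : h != 0 by apply: contraNneq f_neq0 => h0; rewrite h0 dvd0p in hf.
have Eh := size_comp_Xn p_gt0 h_neq0.
have := irr (h \Po 'X^p); rewrite Eh.
have h_gt0 : (0 < size h)%N by rewrite size_poly_gt0.
have f_gt0 : (0 < size f)%N by rewrite size_poly_gt0.
move=> /(_ _ (dvdp_comp_poly _ hf)) E.
rewrite -dvdp_size_eqp //.
have sz_neq1 : ((size h).-1 * p).+1 != 1%N.
  by rewrite eqSS muln_eq0; move: sz_h; lia.
have /eqp_size := E sz_neq1; rewrite Eh Ef => -[/eqP].
by rewrite eqn_pmul2r // => /eqP Ehf; rewrite -(prednK h_gt0) -(prednK f_gt0) Ehf.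
Qed.

(** By Frobenius, X^p - z^p = (X - z)^p, so a factor (X - z^p)^m becomes (X - z)^(pm), and the
    cofactor does not vanish at z. *)
Lemma mup_comp_Xp p (F : {poly Kbar}) z : p \in [pchar Kbar] -> F != 0 ->
  mup z (F \Po 'X^p) = (p * mup (z ^+ p) F)%N.
Proof.
move=> pK F0; have [m [h]] := multiplicity_XsubC F (z ^+ p).
rewrite F0 /= => nh EF.
have -> : mup (z ^+ p) F = m by rewrite EF mupMr // mup_XsubCX eqxx.
rewrite EF comp_polyM rmorphXn /= comp_polyB comp_polyX comp_polyC polyC_exp.
have pP : p \in [pchar {poly Kbar}] by rewrite pchar_poly.
rewrite -!(pFrobenius_autE pP) -rmorphB pFrobenius_autE -exprM.
rewrite mupMr ?mup_XsubCX ?eqxx //.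
by rewrite /root horner_comp hornerXn.
Qed.

(** Induction on the degree. If f' is nonzero, f is separable and q = 1; otherwise f = f1(X^p) with
    f1 irreducible of inseparability degree q / p. *)
Lemma insep_decomp (f : {poly K}) q : irreducible_poly f ->
  is_insep_degree iota f q ->
  exists g, [/\ f = g \Po 'X^q, coprimep g g^`() & [pchar K].-nat q].
Proof.
have [n] := ubnP (size f); elim: n f q => // n IHn f q; rewrite ltnS => lefn.
move=> irr_f hq; have [sz_f _] := irr_f.
have f_neq0 : f != 0 by rewrite -size_poly_gt0; apply: leq_trans sz_f.
have [z fz] : exists z, root (map_poly iota f) z.
  by apply/closed_rootP; rewrite size_map_poly; case: (size f) sz_f => [|[|]].
have [df0|df_neq0] := eqVneq f^`() 0; last first.
  have cop : coprimep f f^`().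
    by rewrite irreducible_poly_coprime // gtNdvdp // lt_size_deriv.
  exists f; have -> : q = 1%N.
    have F0 : map_poly iota f != 0 by rewrite map_poly_eq0.
    apply/eqP; rewrite -(hq z fz) eqn_leq mup_leq // mup_geq // expr1 dvdp_XsubCl fz.
    (* A double root would be a common root of f and f'. *)
    rewrite andbT; apply/negP=> /dvdpP[h Eh].
    have : coprimep (map_poly iota f) (map_poly iota f^`()) by rewrite coprimep_map.
    move=> /coprimep_root/(_ fz); rewrite -deriv_map Eh expr2 mulrA derivM.
    by rewrite hornerD !hornerM hornerXsubC subrr !(mul0r, mulr0, addr0) eqxx.
  by split=> //; rewrite expr1 comp_polyXr.
have [p [f1 [pK Ef]]] := deriv0_comp sz_f df0.
have p_gt1 := prime_gt1 (pcharf_prime pK); have p_gt0 := ltnW p_gt1.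
have irr1 : irreducible_poly f1 by apply: irreducible_comp_Xn p_gt0 _; rewrite -Ef.
have f1_neq0 : map_poly iota f1 != 0.
  by rewrite map_poly_eq0; apply: contraNneq f_neq0 => f10; rewrite Ef f10 comp_poly0.
have mupE z' : mup z' (map_poly iota f) = (p * mup (z' ^+ p) (map_poly iota f1))%N.
  by rewrite Ef map_comp_poly map_polyXn mup_comp_Xp // (fmorph_pchar iota).
have Eq := mupE z; rewrite (hq z fz) in Eq.
pose q1 := mup (z ^+ p) (map_poly iota f1).
have [|//|w f1w|g [Eg cop q1K]] := IHn f1 q1.
- have [sz1 _] := irr1; apply: leq_trans lefn; rewrite Ef size_comp_Xn //.
    case: (size f1) sz1 => [|[|m]] // _.
    by rewrite ltnS -[X in (X < _)%N]muln1 ltn_pmul2l.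
  by rewrite -size_poly_gt0; apply: leq_trans sz1.
(* Any root [w] of [f1] is a p-th power of some [z'], which is then a root of [f], where the
   multiplicity is known to be q. *)
- have [z' Ez'] : exists z', root ('X^p - w%:P) z'.
    by apply/closed_rootP; rewrite size_XnsubC // gtn_eqF.
  have Ew : w = z' ^+ p.
    by move: Ez'; rewrite /root !hornerE subr_eq0 => /eqP.
  have fz' : root (map_poly iota f) z'.
    by rewrite Ef map_comp_poly map_polyXn /root horner_comp hornerXn -Ew.
  have := mupE z'; rewrite (hq _ fz') Eq -Ew -/q1 => /eqP.
  by rewrite (eqn_pmul2l p_gt0) => /eqP <-.
exists g; rewrite Eq -/q1; split=> //; first last.
  rewrite pnatM q1K andbT pnatE //; exact: pcharf_prime pK.
by rewrite Ef Eg -comp_polyA comp_Xn_poly -exprM.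
Qed.

End Inseparability.

(** * Evaluation of polynomials at endomorphisms *)

(* [horner_morph] needs a nonzero target ring, but 'End(V) is zero when V is. *)
Section PzHorner.

Variables (R : nzRingType) (S : pzRingType) (h : {rmorphism R -> S}) (u : S).
Hypothesis hu : forall a, GRing.comm (h a) u.

(** The commutation proof is an argument so that the ring morphism structure can be inferred from
    the term. *)
Definition pz_horner of (forall a, GRing.comm (h a) u) :=
  fun p : {poly R} => \sum_(i < size p) h p`_i * u ^+ i.

Local Notation ev := (pz_horner hu).

Lemma pz_horner_wide n (p : {poly R}) : (size p <= n)%N ->
  ev p = \sum_(i < n) h p`_i * u ^+ i.
Proof.
move=> le_pn; rewrite /pz_horner (big_ord_widen n (fun i => h p`_i * u ^+ i)) //.
rewrite big_mkcond; apply: eq_bigr => i _; case: ltnP => // le_pi.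
by rewrite nth_default // rmorph0 mul0r.
Qed.

Lemma pz_hornerC a : ev a%:P = h a.
Proof.
rewrite (@pz_horner_wide 1) ?size_polyC_leq1 // big_ord1 coefC eqxx.
by rewrite expr0 mulr1.
Qed.

Fact pz_horner_zmod_morphism : zmod_morphism ev.
Proof.
move=> p q; pose n := maxn (size p) (size q).
rewrite !(@pz_horner_wide n) ?leq_maxl ?leq_maxr //; last first.
  by rewrite (leq_trans (size_polyD _ _)) // size_polyN.
rewrite -sumrB; apply: eq_bigr => i _.
by rewrite coefB rmorphB mulrBl.
Qed.
HB.instance Definition _ :=
  GRing.isZmodMorphism.Build {poly R} S ev pz_horner_zmod_morphism.

Lemma pz_hornerMX p : ev (p * 'X) = ev p * u.
Proof.
rewrite (@pz_horner_wide (size p).+1); last first.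
  by rewrite (leq_trans (size_polyMleq _ _)) // size_polyX addn2.
rewrite big_ord_recl coefMX eqxx rmorph0 mul0r add0r mulr_suml.
by apply: eq_bigr => i _; rewrite coefMX /= exprSr mulrA.
Qed.

Lemma pz_hornerX : ev 'X = u.
Proof. by rewrite -[X in ev X]mul1r pz_hornerMX pz_hornerC rmorph1 mul1r. Qed.

Fact pz_horner_monoid_morphism : monoid_morphism ev.
Proof.
split=> [|p q]; first by rewrite pz_hornerC rmorph1.
elim/poly_ind: q => [|q c IHq]; first by rewrite mulr0 raddf0 mulr0.
rewrite mulrDr !raddfD /= mulrDr mulrA !pz_hornerMX IHq -mulrA; congr (_ + _).
rewrite pz_hornerC.
elim/poly_ind: p {IHq} => [|p b IHp]; first by rewrite mul0r raddf0 mul0r.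
rewrite mulrDl !raddfD /= mulrDl -polyCM !pz_hornerC rmorphM; congr (_ + _).
rewrite -mulrA -commr_polyX mulrA pz_hornerMX IHp pz_hornerMX -!mulrA.
by rewrite hu.
Qed.
HB.instance Definition _ :=
  GRing.isMonoidMorphism.Build {poly R} S ev pz_horner_monoid_morphism.

End PzHorner.

(** * The ring of endomorphisms and its commuting pairs *)

Section EndRing.

Variables (K : fieldType) (V : vectType K).

HB.instance Definition _ := GRing.Zmodule_isPzRing.Build 'End(V)
  (@comp_lfunA K V V V V) (@comp_lfun1l K V V) (@comp_lfun1r K V V)
  (@comp_lfunDl K V V V) (@comp_lfunDr K V V V).

Lemma end_mulE (x y : 'End(V)) : (x \o y)%VF = x * y.
Proof. by []. Qed.

Lemma end_mul_lfunE (x y : 'End(V)) v : (x * y) v = x (y v).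
Proof. exact: lfunE. Qed.

Lemma end_one_lfunE v : (1 : 'End(V)) v = v.
Proof. exact: lfunE. Qed.

Lemma end_expE (x : 'End(V)) k : end_exp x k = x ^+ k.
Proof. by elim: k => // k IHk; rewrite exprS -IHk. Qed.

Definition end_scal (a : K) : 'End(V) := a *: \1%VF.

Fact end_scal_zmod_morphism : zmod_morphism end_scal.
Proof. by move=> a b; rewrite /end_scal scalerBl. Qed.
HB.instance Definition _ :=
  GRing.isZmodMorphism.Build K 'End(V) end_scal end_scal_zmod_morphism.

Lemma end_scalM a (x : 'End(V)) : end_scal a * x = a *: x.
Proof. by rewrite -end_mulE -comp_lfunZl comp_lfun1l. Qed.

Fact end_scal_monoid_morphism : monoid_morphism end_scal.
Proof.
by split=> [|a b]; rewrite ?end_scalM /end_scal ?scale1r ?scalerA.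
Qed.
HB.instance Definition _ :=
  GRing.isMonoidMorphism.Build K 'End(V) end_scal end_scal_monoid_morphism.

Lemma comm_end_scal (x : 'End(V)) a : GRing.comm (end_scal a) x.
Proof.
by rewrite /GRing.comm end_scalM -end_mulE -comp_lfunZr comp_lfun1r.
Qed.

Definition peval (x : 'End(V)) : {poly K} -> 'End(V) :=
  pz_horner (comm_end_scal x).
HB.instance Definition _ x := GRing.RMorphism.on (peval x).

Lemma end_hornerE p x : end_horner p x = peval x p.
Proof. by apply: eq_bigr => i _; rewrite end_scalM end_expE. Qed.

Lemma pevalX x : peval x 'X = x.
Proof. exact: pz_hornerX. Qed.

Lemma pevalC x a : peval x a%:P = end_scal a.
Proof. exact: pz_hornerC. Qed.

Lemma pevalZ x a p : peval x (a *: p) = a *: peval x p.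
Proof. by rewrite -mul_polyC rmorphM /= pevalC end_scalM. Qed.

Lemma peval_comp (x : 'End(V)) (g p : {poly K}) : peval x (g \Po p) = peval (peval x p) g.
Proof.
elim/poly_ind: g => [|g c IHg]; first by rewrite comp_poly0 !rmorph0.
by rewrite comp_poly_MXaddC !rmorphD !rmorphM /= IHg !pevalC pevalX.
Qed.

Lemma comm_peval (x y : 'End(V)) : GRing.comm x y ->
  forall p, GRing.comm (peval x p) y.
Proof.
move=> cxy; elim/poly_ind=> [|p c IHp].
  by rewrite rmorph0; apply/commr_sym/commr0.
rewrite rmorphD rmorphM /= pevalX pevalC; apply/commr_sym/commrD.
  by apply: commrM; apply/commr_sym.
exact/commr_sym/comm_end_scal.
Qed.

Section Bivariate.

Variables (a b : 'End(V)) (cab : GRing.comm a b).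

(** Transports identities from the commutative ring of bivariate polynomials to the commuting pair;
    the inner variable goes to [a], the outer one to [b]. *)
Definition peval2 : {poly {poly K}} -> 'End(V) := pz_horner (comm_peval cab).
HB.instance Definition _ := GRing.RMorphism.on peval2.

Lemma peval2X : peval2 'X = b.
Proof. exact: pz_hornerX. Qed.

Lemma peval2C p : peval2 p%:P = peval a p.
Proof. exact: pz_hornerC. Qed.

Lemma peval2_horner (c : {poly {poly K}}) (g : {poly K}) :
  peval2 (map_poly (polyC \o polyC) g).[c] = peval (peval2 c) g.
Proof.
elim/poly_ind: g => [|g k IHg]; first by rewrite !rmorph0 horner0 rmorph0.
rewrite !rmorphD !rmorphM /= map_polyX map_polyC /= hornerD hornerMX hornerC.
by rewrite rmorphD rmorphM /= IHg pevalX pevalC peval2C pevalC.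
Qed.

(** Image under [peval2] of Taylor's formula at two indeterminates; all values of [peval2] commute,
    in particular the remainder and [b]. *)
Lemma peval_taylor (g : {poly K}) : exists w : 'End(V),
  peval (a + b) g = peval a g + b * (peval a g^`() + b * w)
  /\ GRing.comm w b.
Proof.
pose G := map_poly (polyC \o polyC) g : {poly {poly {poly K}}}.
have [W EW] := horner_taylor2 G 'X%:P 'X.
exists (peval2 W); split.
  have := congr1 peval2 EW; rewrite !(rmorphD, rmorphM) /= deriv_map.
  by rewrite !peval2_horner !(rmorphD, rmorphM) /= peval2C peval2X pevalX.
by rewrite -[X in GRing.comm _ X]peval2X; rewrite /GRing.comm -!rmorphM mulrC.
Qed.

Lemma exprD_pchar_comm q : [pchar K].-nat q -> (a + b) ^+ q = a ^+ q + b ^+ q.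
Proof.
move=> qK; have qP : [pchar {poly {poly K}}].-nat q.
  by rewrite (eq_pnat _ (pchar_poly _)) (eq_pnat _ (pchar_poly _)).
have := congr1 peval2 (exprDn_pchar 'X%:P 'X qP).
by rewrite !(rmorphD, rmorphXn) /= peval2C peval2X pevalX.
Qed.

End Bivariate.

End EndRing.

(** * Semisimple endomorphisms *)

Section Semisimple.

Variables (K : fieldType) (V : vectType K).
Implicit Types (s x : 'End(V)) (U W : {vspace V}).

Lemma stable_peval s U p v : stable_sub s U -> v \in U -> peval s p v \in U.
Proof.
move=> sU; elim/poly_ind: p v => [|p c IHp] v vU.
  by rewrite rmorph0 zero_lfunE mem0v.
rewrite rmorphD rmorphM /= pevalX pevalC add_lfunE end_mul_lfunE memvD //.
  by apply: IHp; apply: (subvP sU); apply: memv_img.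
by rewrite scale_lfunE id_lfunE memvZ.
Qed.

Lemma irr_coprime (f p : {poly K}) : irreducible_poly f -> ~~ (f %| p) ->
  exists u v, u * p + v * f = 1.
Proof.
move=> irr_f nfp; have cop : coprimep p f.
  by rewrite coprimep_sym irreducible_poly_coprime.
have /Bezout_eq1_coprimepP [[u v] /= Euv] := cop.
by exists u, v.
Qed.

Section Simple.

Variables (f : {poly K}) (s : 'End(V)).
Hypotheses (irr_f : irreducible_poly f) (fs0 : peval s f = 0).

Let d := (size f).-1.

Let f_neq0 : f != 0.
Proof. by case: irr_f; case: eqP => // ->; rewrite size_poly0. Qed.

Lemma peval_modp p : peval s (p %% f) = peval s p.
Proof.
by rewrite [in RHS](divp_eq p f) rmorphD rmorphM /= fs0 mulr0 add0r.
Qed.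

Fact cyc_fun_linear v : linear (fun p : {poly_d K} => peval s (val p) v).
Proof.
move=> c p q; have -> : val (c *: p + q) = c *: val p + val q by [].
by rewrite rmorphD /= pevalZ add_lfunE scale_lfunE.
Qed.

Definition cyc_fun v : {poly_d K} -> V := fun p => peval s (val p) v.
HB.instance Definition _ v := GRing.isSemilinear.Build K {poly_d K} V _ (cyc_fun v)
  (GRing.semilinear_linear (cyc_fun_linear v)).

(** The submodule K[s] v. As f(s) = 0, polynomials of degree less than deg f suffice, and they form
    a finite-dimensional space. *)
Definition cyc v : {vspace V} := limg (linfun (cyc_fun v)).

Lemma mem_cycP v w : reflect (exists p, w = peval s p v) (w \in cyc v).
Proof.
apply: (iffP memv_imgP) => [[p _ ->]|[p ->]].
  by exists (val p); rewrite lfunE.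
have sz : (size (p %% f)%R <= d)%N.
  by rewrite -ltnS prednK ?ltn_modpN0 // size_poly_gt0.
exists (@npolyp K d (p %% f)); rewrite ?memvf // lfunE /= /cyc_fun /=.
by rewrite npolypK // peval_modp.
Qed.

Lemma peval_invertible p : ~~ (f %| p) -> exists u, peval s u * peval s p = 1.
Proof.
move=> /(irr_coprime irr_f) [u [v Euv]]; exists u.
by rewrite -rmorphM -[LHS]addr0 -(mulr0 (peval s v)) -fs0 -rmorphM -rmorphD Euv rmorph1.
Qed.

(** Since p(s) is invertible unless f divides p, no nonzero polynomial of degree less than deg f
    annihilates v. *)
Lemma dim_cyc v : v != 0 -> \dim (cyc v) = d.
Proof.
move=> v_neq0; rewrite limg_dim_eq ?dim_polyn //.
apply/eqP; rewrite -subv0; apply/subvP => p; rewrite memv_cap memvf memv_ker.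
rewrite lfunE memv0 /= => /eqP Ep; apply/eqP/val_inj => /=.
have [fp|nfp] := boolP (f %| val p).
  apply: (contraTeq _ fp) => p_neq0; rewrite gtNdvdp //.
  by rewrite (leq_ltn_trans (size_npoly p)) // prednK ?size_poly_gt0.
have [u Eu] := peval_invertible nfp.
case/eqP: v_neq0; rewrite -[v]end_one_lfunE -Eu end_mul_lfunE.
by move: Ep; rewrite /cyc_fun => ->; rewrite linear0.
Qed.

Lemma stable_cyc v : stable_sub s (cyc v).
Proof.
apply/subvP => _ /memv_imgP[w /mem_cycP[p ->] ->]; apply/mem_cycP.
by exists ('X * p); rewrite rmorphM /= pevalX end_mul_lfunE.
Qed.

Lemma cyc_mem v p : ~~ (f %| p) -> v \in cyc (peval s p v).
Proof.
move=> /peval_invertible[u Eu]; apply/mem_cycP; exists u.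
by rewrite -end_mul_lfunE Eu end_one_lfunE.
Qed.

Lemma cyc_sub v U : stable_sub s U -> v \in U -> (cyc v <= U)%VS.
Proof. by move=> sU vU; apply/subvP => _ /mem_cycP[p ->]; apply: stable_peval. Qed.

Lemma cyc_neq0_mem v w : w \in cyc v -> w != 0 -> v \in cyc w.
Proof.
case/mem_cycP => p -> nz; apply: cyc_mem; apply: contraNN nz => /dvdpP[g ->].
by rewrite rmorphM /= fs0 mulr0 zero_lfunE.
Qed.

Lemma simple_cyc v : v != 0 -> simple_sub s (cyc v).
Proof.
move=> v_neq0; split; first exact: stable_cyc.
  rewrite -dimv_eq0 dim_cyc // -lt0n -ltnS prednK ?size_poly_gt0 //.
  by case: irr_f.
move=> W sW WU; have [->|W_neq0] := eqVneq W 0%VS; [by left|right].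
apply/eqP; rewrite eqEsubv WU; have := memv_pick W.
move=> wW; apply: cyc_sub => //; have w_neq0 : vpick W != 0 by rewrite vpick0.
have /cyc_neq0_mem/(_ w_neq0) := subvP WU _ wW.
by apply/subvP; apply: cyc_sub.
Qed.

(** V is a vector space over the field K[X]/(f), with the [cyc v] as lines; a basis of U is built
    one vector at a time. *)
Lemma stable_simple_sum U : stable_sub s U ->
  exists (r : nat) (F : nat -> {vspace V}),
    [/\ forall i, (i < r)%N -> simple_sub s (F i) /\ \dim (F i) = d,
        (\sum_(i < r) F i)%VS = U & directv (\sum_(i < r) F i)].
Proof.
move=> sU.
(* Taking k above dim U leaves only the first alternative: that many independent summands of
   positive dimension do not fit into U. *)
suff main k : exists (r : nat) (F : nat -> {vspace V}),
    [/\ forall i, (i < r)%N -> simple_sub s (F i) /\ \dim (F i) = d,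
        (\sum_(i < r) F i <= U)%VS, directv (\sum_(i < r) F i) &
        (\sum_(i < r) F i)%VS = U \/ (k <= r)%N].
  have [r [F [sF leU dF [<-|]]]] := main (\dim U).+1; first by exists r, F.
  move=> ltr; have := dimvS leU; move: dF; rewrite directvE /= => /eqP->.
  rewrite (eq_bigr (fun=> d)) => [|i _]; last by have [] := sF i (ltn_ord i).
  have d_gt0 : (0 < d)%N by rewrite -ltnS prednK ?size_poly_gt0 //; case: irr_f.
  by rewrite sum_nat_const card_ord; nia.
elim: k => [|k [r [F [sF leU dF]]]].
  exists 0, (fun=> 0%VS); split=> //; last by right.
    by rewrite big_ord0 sub0v.
  by rewrite directvE /= !big_ord0 dimv0.
case=> [<-|ltr]; first by exists r, F; split=> //; left.
have [<-|neqU] := eqVneq (\sum_(i < r) F i)%VS U; first by exists r, F; split=> //; left.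
set W := (\sum_(i < r) F i)%VS in leU dF neqU *.
have sW : stable_sub s W.
  rewrite /stable_sub limg_sum; apply/subv_sumP => i _.
  have [[sFi _ _] _] := sF i (ltn_ord i).
  exact: subv_trans sFi (sumv_sup i _ _).
have /subvPn[v vU vW] : ~~ (U <= W)%VS by move: neqU; rewrite eqEsubv leU.
have v_neq0 : v != 0 by apply: contraNneq vW => ->; apply: mem0v.
pose F' i := if (i < r)%N then F i else cyc v.
have EF' : (\sum_(i < r.+1) F' i)%VS = (W + cyc v)%VS.
  rewrite big_ord_recr /= {2}/F' ltnn; congr (_ + _)%VS.
  by apply: eq_bigr => i _; rewrite /F' ltn_ord.
(* A nonzero common vector [w] would generate [v], putting [v] in [W]. *)
have Wv : (W :&: cyc v = 0)%VS.
  apply/eqP; rewrite -subv0; apply/subvP => w; rewrite memv_cap memv0.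
  case/andP=> wW wv; apply: contraNT vW => w_neq0.
  by apply: (subvP (cyc_sub sW wW)); apply: cyc_neq0_mem.
exists r.+1, F'; split.
- move=> i _; rewrite /F'; case: ifP => [/sF //|_]; split; last exact: dim_cyc.
  exact: simple_cyc.
- by rewrite EF' subv_add leU cyc_sub.
- rewrite directvE /= EF' dimv_disjoint_sum //; apply/eqP.
  rewrite big_ord_recr /= {2}/F' ltnn; congr (_ + _)%N.
  move: dF; rewrite directvE /= => /eqP->.
  by apply: eq_bigr => i _; rewrite /F' ltn_ord.
- by right.
Qed.

Lemma dvd_dim_stable U : stable_sub s U -> (d %| \dim U)%N.
Proof.
case/stable_simple_sum => r [F [sF <-]]; rewrite directvE /= => /eqP->.
by apply: dvdn_sum => i _; have [_ ->] := sF i (ltn_ord i).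
Qed.

Lemma root_semisimple : semisimple_end s.
Proof.
have [|r [F [sF eF dF]]] := @stable_simple_sum fullv; first exact: subvf.
by exists r, (fun i => F i); split=> // i; have [] := sF i (ltn_ord i).
Qed.

End Simple.

(** On a simple summand the image of f(s) is stable, hence zero or everything; a nilpotent map of a
    nonzero space is not onto. *)
Lemma semisimple_root (f : {poly K}) s k : semisimple_end s ->
  peval s f ^+ k = 0 -> peval s f = 0.
Proof.
case=> r [U [sU fullU _]] nil.
have simp0 i v : v \in U i -> peval s f v = 0.
  have [stU U_neq0 minU] := sU i.
  have csf : GRing.comm s (peval s f).
    by rewrite -{1}[s]pevalX /GRing.comm -!rmorphM mulrC.
  have le : (peval s f @: U i <= U i)%VS.
    by apply/subvP => _ /memv_imgP[w wU ->]; apply: stable_peval.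
  have st : stable_sub s (peval s f @: U i)%VS.
    apply/subvP => _ /memv_imgP[_ /memv_imgP[w wU ->] ->].
    rewrite -end_mul_lfunE csf end_mul_lfunE memv_img //.
    by apply: (subvP stU); apply: memv_img.
  case: (minU _ st le) => [E0|E1] vU.
    by apply/eqP; rewrite -memv0 -E0 memv_img.
  case/eqP: U_neq0; suff Ek j : ((peval s f ^+ j)%R @: U i)%VS = U i.
    by rewrite -(Ek k) nil; apply/eqP; rewrite -subv0; apply/subvP => _
      /memv_imgP[w _ ->]; rewrite zero_lfunE mem0v.
  elim: j => [|j IHj]; first by rewrite expr0 lim1g.
  by rewrite exprSr -end_mulE limg_comp E1 IHj.
apply/lfunP => v; rewrite zero_lfunE; have : v \in fullv by rewrite memvf.
rewrite -fullU => /memv_sumP[w wU ->]; rewrite linear_sum big1 // => i _.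
by apply: simp0; apply: wU.
Qed.

End Semisimple.

(** * Invariants *)

Section QPoly.

Variables (K : fieldType) (f : {poly K}).
Hypotheses (f_monic : f \is monic) (irr_f : irreducible_poly f).

Let d := (size f).-1.

Lemma irr_size_gt0 : (0 < d)%N.
Proof. by rewrite -ltnS prednK; case: irr_f => // /ltnW. Qed.

Lemma size_fX k : size (f ^+ k) = (d * k).+1.
Proof.
by rewrite -[LHS]prednK ?size_exp // size_poly_gt0 expf_neq0 ?monic_neq0.
Qed.

(** [{poly %/ h}] is formed modulo [mk_monic h], which equals [h] when [h] is monic and
    nonconstant. *)
Lemma mk_monic_fX k : (0 < k)%N -> mk_monic (f ^+ k) = f ^+ k.
Proof.
by move=> k_gt0; rewrite /mk_monic size_fX ltnS muln_gt0 irr_size_gt0 k_gt0 monic_exp.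
Qed.

Lemma val_in_qpoly k p : (0 < k)%N ->
  val (in_qpoly (f ^+ k) p) = p %% f ^+ k.
Proof.
move=> k_gt0; rewrite /= mk_monic_fX //.
by rewrite Pdiv.IdomainMonic.modpE // monic_exp.
Qed.

Lemma in_qpoly_eq0 k p : (0 < k)%N -> (in_qpoly (f ^+ k) p == 0) = (f ^+ k %| p).
Proof. by move=> k_gt0; rewrite -val_eqE val_in_qpoly. Qed.

Lemma in_qpolyK k (a : {poly %/ f ^+ k}) : in_qpoly (f ^+ k) (val a) = a.
Proof. exact/val_inj/in_qpoly_small/size_mk_monic. Qed.

Lemma dvdp_fX_sub m j p : (f ^+ m %| f ^+ j * p) = (f ^+ (m - j) %| p).
Proof.
have [lejm|/ltnW lemj] := leqP j m.
  by rewrite -{1}(subnKC lejm) exprD dvdp_mul2l // expf_neq0 ?monic_neq0.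
have -> : (m - j = 0)%N by apply/eqP; rewrite subn_eq0.
by rewrite expr0 dvd1p dvdp_mulr // dvdp_exp2l.
Qed.

End QPoly.

Section Invariants.

Variables (K : fieldType) (V : vectType K) (f : {poly K}) (x : 'End(V)).
Hypotheses (f_monic : f \is monic) (irr_f : irreducible_poly f).
Variables (lam : nat -> nat) (r : nat).
Hypothesis lam_gt0 : forall i : 'I_r, (0 < lam i)%N.
Variable phi : forall i : 'I_r, {linear V -> {poly %/ f ^+ lam i}}.
Hypothesis phiX : forall i v, phi i (x v) = 'qX * phi i v.
Hypothesis phi_bij : bijective (fun v : V => [ffun i : 'I_r => phi i v]
              : {dffun forall i : 'I_r, {poly %/ f ^+ lam i}}).

Let d := (size f).-1.

Lemma phi_inj u v : (forall i, phi i u = phi i v) -> u = v.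
Proof.
move=> Euv; apply: (bij_inj phi_bij); apply/ffunP => i; rewrite !ffunE.
exact: Euv.
Qed.

Lemma phi_surj (a : forall i : 'I_r, {poly %/ f ^+ lam i}) :
  exists v, forall i, phi i v = a i.
Proof.
have [psi _ Kpsi] := phi_bij.
pose A := [ffun i => a i] : {dffun forall i : 'I_r, {poly %/ f ^+ lam i}}.
by exists (psi A) => i; have /ffunP/(_ i) := Kpsi A; rewrite !ffunE.
Qed.

Lemma phi_peval i p v : phi i (peval x p v) = in_qpoly (f ^+ lam i) p * phi i v.
Proof.
elim/poly_ind: p v => [|p c IHp] v.
  by rewrite rmorph0 zero_lfunE linear0 in_qpoly0 mul0r.
rewrite rmorphD rmorphM /= pevalX pevalC add_lfunE end_mul_lfunE linearD IHp phiX.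
rewrite scale_lfunE id_lfunE linearZ /= in_qpolyD in_qpolyM mulrDl mulrA.
congr (_ + _); rewrite -[c%:P]mulr1 mul_polyC in_qpolyZ in_qpoly1.
by rewrite -scalerAl mul1r.
Qed.

Lemma phi_peval_eq0 i p v :
  (phi i (peval x p v) == 0) = (f ^+ lam i %| p * val (phi i v)).
Proof.
rewrite phi_peval -{1}[phi i v](@in_qpolyK K f (lam i)) -in_qpolyM.
by rewrite in_qpoly_eq0.
Qed.

Section Kernel.

Variable j : nat.

Let k := (fun i : 'I_r => d * (lam i - j))%N.

(** Induces an isomorphism from V / ker f(x)^j to the sum of the K[T]/(f^(lam i - j)), written in
    coordinates so that the dimension of the target is known. Blocks with lam i <= j are empty. *)
Definition residue (v : V) : 'rV[K]_(\sum_i k i) :=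
  \mxrow_i poly_rV (val (phi i v) %% f ^+ (lam i - j)).

Fact residue_linear : linear residue.
Proof.
move=> c u v; apply/mxrowP => i; rewrite submxrowD.
have -> : submxrow (c *: residue u) i = c *: submxrow (residue u) i by apply: linearZ.
by rewrite !mxrowK linearP /= modpD modpZl linearP.
Qed.
HB.instance Definition _ := GRing.isSemilinear.Build K V _ _ residue
  (GRing.semilinear_linear residue_linear).

Lemma residue_eq0 v : (residue v == 0) = ((peval x f ^+ j) v == 0).
Proof.
apply/eqP/eqP => [E|E].
  apply: phi_inj => i; rewrite linear0 -rmorphXn /=; apply/eqP.
  rewrite phi_peval_eq0 dvdp_fX_sub //.
  have : submxrow (residue v) i = 0 by rewrite E submxrow0.
  rewrite mxrowK => Ei; rewrite /dvdp -[X in X == 0](@poly_rV_K _ (k i)).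
    by rewrite Ei linear0.
  by rewrite -ltnS -size_fX // ltn_modpN0 // expf_neq0 ?monic_neq0.
apply/mxrowP => i; rewrite submxrow0 mxrowK.
have := phi_peval_eq0 i (f ^+ j) v.
rewrite rmorphXn E linear0 eqxx dvdp_fX_sub // => /esym/eqP->.
by rewrite linear0.
Qed.

(** Rank-nullity for [residue], which is onto with kernel ker f(x)^j. *)
Lemma dim_ker_pow : (\dim (fullv : {vspace V}) =
  \dim (lker (peval x f ^+ j)) + d * \sum_(i < r) (lam i - j))%N.
Proof.
rewrite -(limg_ker_dim (linfun residue) fullv) capfv; congr (_ + _)%N.
  congr (\dim _); apply/vspaceP => v.
  by rewrite !memv_ker lfunE residue_eq0.
have -> : limg (linfun residue) = fullv.
  apply/vspaceP => w; rewrite memvf; apply/memv_imgP.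
  have [v Ev] := phi_surj (fun i => in_qpoly (f ^+ lam i) (rVpoly (submxrow w i))).
  exists v; rewrite ?memvf // lfunE; apply/mxrowP => i; rewrite mxrowK Ev.
  have sz : (size (rVpoly (submxrow w i)) <= d * (lam i - j))%N by apply: size_poly.
  have sz' : (size (rVpoly (submxrow w i)) <= d * lam i)%N.
    by apply: leq_trans sz _; rewrite leq_mul2l leq_subr orbT.
  by rewrite val_in_qpoly // !modp_small ?rVpolyK // size_fX // ltnS.
by rewrite dimvf dim_matrix -[LHS]/(1 * _)%N mul1n big_distrr.
Qed.

End Kernel.

Lemma dim_ker_step j : (\dim (lker (peval x f ^+ j.+1)) =
  \dim (lker (peval x f ^+ j)) + d * \sum_(i < r) (j < lam i))%N.
Proof.
have := dim_ker_pow j; rewrite (dim_ker_pow j.+1).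
have -> : (\sum_(i < r) (lam i - j) =
    \sum_(i < r) (lam i - j.+1) + \sum_(i < r) (j < lam i))%N.
  by rewrite -big_split /=; apply: eq_bigr => i _; lia.
by rewrite mulnDr; lia.
Qed.

(** Preimages under [phi] of the standard generators of the summands. *)
Lemma exists_generators : exists e : 'I_r -> V,
  [/\ forall i : 'I_r, peval x (f ^+ lam i) (e i) = 0,
      forall i l : 'I_r, val (phi l (e i)) = (l == i)%:R &
      forall v, v = \sum_i peval x (val (phi i v)) (e i)].
Proof.

have [e Ee] : exists e : 'I_r -> V, forall i l : 'I_r, phi l (e i) = (l == i)%:R.
  have [psi _ Kpsi] := phi_bij.
  pose A i := [ffun l => (l == i)%:R] : {dffun forall i : 'I_r, {poly %/ f ^+ lam i}}.
  by exists (fun i => psi (A i)) => i l; have /ffunP/(_ l) := Kpsi (A i); rewrite !ffunE.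
exists e; split=> [i|i l|v].
- apply: phi_inj => l; rewrite linear0; apply/eqP; rewrite phi_peval_eq0 Ee.
  by have [->|_] := eqVneq l i; rewrite ?mulr1 ?mulr0 ?dvdpp ?dvdp0.
- by rewrite Ee; case: eqP.
- apply: phi_inj => l; rewrite linear_sum (bigD1 l) //= big1 ?addr0.
    by rewrite phi_peval Ee eqxx mulr1 (@in_qpolyK K f).
  by move=> i /negPf nil; rewrite phi_peval Ee eq_sym nil mulr0.
Qed.

End Invariants.

(** * Kernels of the powers of an endomorphism *)

Section Ends.
Variables (K : fieldType) (V : vectType K).
Implicit Types n : 'End(V).

Lemma dim_lker_expS_le n k :
  (\dim (lker (n ^+ k)) <= \dim (lker (n ^+ k.+1)))%N.
Proof.
apply/dimvS/subvP => v; rewrite !memv_ker exprS end_mul_lfunE => /eqP->.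
by rewrite linear0.
Qed.

(** The increment dim ker n^(j+1) - dim ker n^j is the dimension of n^j(ker n^(j+1)), and these
    images decrease with j because n maps ker n^(k+2) into ker n^(k+1). *)
Lemma dim_lker_exp_concave n k :
  (\dim (lker (n ^+ k.+2)) + \dim (lker (n ^+ k)) <= 2 * \dim (lker (n ^+ k.+1)))%N.
Proof.
have sub j : (lker (n ^+ j) <= lker (n ^+ j.+1))%VS.
  by apply/subvP => v; rewrite !memv_ker exprS end_mul_lfunE => /eqP->; rewrite linear0.
have step j : (\dim (lker (n ^+ j)) + \dim ((n ^+ j)%R @: lker (n ^+ j.+1)%R) =
    \dim (lker (n ^+ j.+1)))%N.
  by rewrite -(limg_ker_dim (n ^+ j) (lker (n ^+ j.+1))) (capv_idPr (sub j)).
have : (\dim ((n ^+ k.+1)%R @: lker (n ^+ k.+2)%R) <=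
        \dim ((n ^+ k)%R @: lker (n ^+ k.+1)%R))%N.
  apply/dimvS/subvP => _ /memv_imgP[v kv ->]; apply/memv_imgP; exists (n v).
    by move: kv; rewrite !memv_ker exprSr end_mul_lfunE.
  by rewrite exprSr end_mul_lfunE.
by have := step k; have := step k.+1; lia.
Qed.

End Ends.

Lemma sum_ltn_ord r N : (\sum_(i < r) (i < N)%N = minn r N)%N.
Proof.
elim: r => [|r IHr]; first by rewrite big_ord0 min0n.
by rewrite big_ord_recr /= IHr; lia.
Qed.

(** * Comparison of the dual partitions *)

Section Arithmetic.

Variables (E lam : nat -> nat) (d q r : nat).
Hypotheses (d_gt0 : (0 < d)%N) (q_gt0 : (0 < q)%N).
Hypothesis lamS : forall i, (lam i.+1 <= lam i)%N.
Hypothesis lam0 : forall i, (r <= i)%N -> lam i = 0.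
Hypothesis E_mono : forall k, (E k <= E k.+1)%N.
Hypothesis E_conc : forall k, (E k.+2 + E k <= 2 * E k.+1)%N.
Hypothesis E_dvd : forall k, (d %| E k)%N.
Hypothesis E_lam : forall j,
  (E (q * j.+1) = E (q * j) + d * \sum_(i < r) (j < lam i))%N.

Lemma lam_antitone i j : (i <= j)%N -> (lam j <= lam i)%N.
Proof.
by move/subnK <-; elim: (j - i)%N => // k; apply/leq_trans; rewrite addSn.
Qed.

(* [E k] stands for dim ker n^k, and [mu] below for the dual partition of n over
   the field K[s]. *)
Lemma balanced_blocks t : (lam (t * q) <= 1 + lam (t * q + q.-1))%N.
Proof.
pose mu k := ((E k.+1 - E k) %/ d)%N.
have Emu k : (E k.+1 = E k + d * mu k)%N.
  by rewrite mulnC divnK ?dvdn_sub // subnKC.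
have muS k : (mu k.+1 <= mu k)%N.
  by rewrite leq_div2r //; have := E_conc k; have := E_mono k; lia.
have mu_anti i j : (i <= j)%N -> (mu j <= mu i)%N.
  by move/subnK <-; elim: (j - i)%N => // k; apply/leq_trans; rewrite addSn.
have Esum a b : (E (a + b) = E a + d * \sum_(i < b) mu (a + i))%N.
  elim: b => [|b IHb]; first by rewrite big_ord0 muln0 !addn0.
  by rewrite addnS Emu IHb big_ord_recr /= mulnDr addnA.
(* The dual partition of [lam]; each part is a sum of q consecutive parts of [mu]. *)
pose c j := (\sum_(i < r) (j < lam i))%N.
have cE j : c j = (\sum_(i < q) mu (q * j + i))%N.
  apply/eqP; rewrite -(eqn_pmul2l d_gt0) -(eqn_add2l (E (q * j))).
  by rewrite -E_lam -Esum mulnS addnC.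
(* If the inequality fails, at least tq + 1 invariants exceed j + 1, but at most tq + q - 1 exceed
   j. *)
rewrite leqNgt; apply/negP; set j := lam (t * q + q.-1) => gt.
have lt_tq_r : (t * q < r)%N.
  by rewrite ltnNge; apply/negP => /lam0 E0; rewrite E0 in gt.
have c_hi : (c j <= t * q + q.-1)%N.
  apply: (@leq_trans (minn r (t * q + q.-1))); last exact: geq_minr.
  rewrite -sum_ltn_ord; apply: leq_sum => i _.
  case: (ltnP j (lam i)) => // lt; rewrite lt0b ltnNge; apply/negP => /lam_antitone.
  by rewrite -/j leqNgt lt.
have c_lo : (t * q + 1 <= c j.+1)%N.
  apply: (@leq_trans (minn r (t * q + 1))); first by lia.
  rewrite -sum_ltn_ord; apply: leq_sum => i _.
  case: ltnP => //; rewrite addn1 ltnS => /lam_antitone le.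
  by rewrite lt0b; apply: leq_trans le.
(* [M] is the last part of [mu] in the j-th block, so c (j+1) <= qM <= c j. This puts qM strictly
   between tq and (t+1)q, which is impossible. *)
set M := mu (q * j + q.-1).
have c_ge : (q * M <= c j)%N.
  rewrite cE -[X in (X * _ <= _)%N]card_ord -sum_nat_const; apply: leq_sum => i _.
  by apply: mu_anti; have := ltn_ord i; lia.
have c_le : (c j.+1 <= q * M)%N.
  rewrite cE -[X in (_ <= X * _)%N]card_ord -sum_nat_const; apply: leq_sum => i _.
  by apply: mu_anti; rewrite mulnS; lia.
have : (t < M)%N by nia.
by nia.
Qed.

End Arithmetic.

(** * Consequences of a Jordan-Chevalley decomposition *)

Section Necessity.

Variables (K : fieldType) (V : vectType K) (x : 'End(V)) (f g : {poly K}) (q : nat).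
Hypotheses (q_gt0 : (0 < q)%N) (fE : f = g \Po 'X^q).
Hypotheses (cop : coprimep g g^`()) (qK : [pchar K].-nat q).

(** Here f(s + n) = g(s^q + n^q) with g(s^q) = f(s) = 0, so Taylor expansion leaves n^q times u =
    g'(s^q) + n^q w, an invertible map plus a commuting nilpotent one. *)
Lemma peval_add_nilp (s n : 'End(V)) m : GRing.comm s n -> peval s f = 0 -> n ^+ m = 0 ->
  exists u, [/\ peval (s + n) f = n ^+ q * u, GRing.comm u (n ^+ q) & lker u = 0%VS].
Proof.
move=> csn fs nm; have csnq : GRing.comm (s ^+ q) (n ^+ q).
  exact/commrX/commr_sym/commrX/commr_sym.
have [w [Ew cw]] := peval_taylor csnq g.
have g0 : peval (s ^+ q) g = 0.
  by move: fs; rewrite fE peval_comp rmorphXn /= pevalX.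
exists (peval (s ^+ q) g^`() + n ^+ q * w); split.
- by rewrite fE peval_comp rmorphXn /= pevalX exprD_pchar_comm // Ew g0 add0r.
- apply/commr_sym/commrD; first exact/commr_sym/comm_peval.
  by apply: commrM; [apply: commr_refl | apply: commr_sym].
have /Bezout_eq1_coprimepP[[a b] /= Eab] := cop.
have Eb : peval (s ^+ q) b * peval (s ^+ q) g^`() = 1.
  by rewrite -rmorphM -[RHS](rmorph1 (peval (s ^+ q))) -Eab rmorphD !rmorphM /=
    g0 mulr0 add0r.
apply/eqP; rewrite -subv0; apply/subvP => v; rewrite memv_ker memv0 => /eqP uv.
(* If u v = 0, inverting g'(s^q) gives v = n^q t v; iterating this m times kills v. *)
pose t := - (peval (s ^+ q) b * w).
have ct : GRing.comm (n ^+ q) t.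
  apply/commrN/commrM; last exact: commr_sym.
  exact/commr_sym/comm_peval.
have Ev : v = (n ^+ q * t) v.
  have : (peval (s ^+ q) b * (peval (s ^+ q) g^`() + n ^+ q * w)) v = 0.
    by rewrite end_mul_lfunE uv linear0.
  rewrite mulrDr Eb add_lfunE end_one_lfunE => /eqP; rewrite addr_eq0 => /eqP{1}->.
  by rewrite mulrN opp_lfunE !mulrA (comm_peval csnq).
have Evk k : v = ((n ^+ q * t) ^+ k) v.
  elim: k => [|k IHk]; first by rewrite expr0 end_one_lfunE.
  by rewrite exprS end_mul_lfunE -IHk.
apply/eqP; rewrite (Evk m) exprMn_comm // -exprM mulnC exprM nm expr0n.
by rewrite gtn_eqF // mul0r zero_lfunE.
Qed.

(** By Taylor expansion at x, f^k(s) = f^k(x - n) is a multiple of n by a commuting factor, hence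
    nilpotent; semisimplicity then gives f(s) = 0. *)
Lemma JC_root k : peval x f ^+ k = 0 -> has_Jordan_Chevalley x ->
  exists s n m, [/\ x = s + n, GRing.comm s n, peval s f = 0 & n ^+ m = 0].
Proof.
move=> fk [s [n [Ex csn ss [m]]]]; rewrite end_expE => nm.
exists s, n, m; split=> //.
have cxn : GRing.comm x (- n).
  by apply: commrN; rewrite Ex; apply/commr_sym/commrD => //; apply: commr_sym.
have [w [Ew cw]] := peval_taylor cxn (f ^+ k).
apply: (@semisimple_root _ _ _ _ (k * m) ss).
have -> : s = x + - n by rewrite Ex addrK.
rewrite exprM -rmorphXn /= Ew rmorphXn /= fk add0r exprMn_comm.
  by rewrite exprNn nm mulr0 mul0r.
apply: commrD; first exact/commr_sym/comm_peval.
by apply: commrM; [apply: commr_refl | apply: commr_sym].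
Qed.

End Necessity.

(** * The criterion *)

Section Main.

Variables (K : fieldType) (V : vectType K) (f : {poly K}) (x : 'End(V)).
Hypotheses (f_monic : f \is monic) (irr_f : irreducible_poly f).
Variables (lam : nat -> nat) (r : nat).
Hypothesis lam_gt0 : forall i : 'I_r, (0 < lam i)%N.
Variable phi : forall i : 'I_r, {linear V -> {poly %/ f ^+ lam i}}.
Hypothesis phiX : forall i v, phi i (x v) = 'qX * phi i v.
Hypothesis phi_bij : bijective (fun v : V => [ffun i : 'I_r => phi i v]
              : {dffun forall i : 'I_r, {poly %/ f ^+ lam i}}).
Hypothesis lamS : forall i, (lam i.+1 <= lam i)%N.
Hypothesis lam0 : forall i, (r <= i)%N -> lam i = 0.

Variables (g : {poly K}) (q k : nat).
Hypotheses (q_gt0 : (0 < q)%N) (fE : f = g \Po 'X^q).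
Hypotheses (cop : coprimep g g^`()) (qK : [pchar K].-nat q).
Hypothesis fk : peval x f ^+ k = 0.

Lemma JC_balanced : has_Jordan_Chevalley x ->
  forall t, (lam (t * q) <= 1 + lam (t * q + q.-1))%N.
Proof.
case/(JC_root fk) => s [n [m [Ex csn fs nm]]].
have [u [Efx cu u0]] := peval_add_nilp q_gt0 fE cop qK csn fs nm.
(* The factor [u] is injective and commutes with n^q, so it does not affect the kernels. *)
have kerE j : lker (peval x f ^+ j) = lker (n ^+ (q * j)).
  apply/vspaceP => v; rewrite !memv_ker Ex Efx exprMn_comm; last exact: commr_sym.
  have cuj : GRing.comm (u ^+ j) (n ^+ q ^+ j).
    exact/commrX/commr_sym/commrX/commr_sym.
  rewrite -cuj -exprM end_mul_lfunE.
  have u_inj w : u w = 0 -> w = 0.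
    by move=> uw; apply/eqP; rewrite -memv0 -u0 memv_ker uw.
  have uj_inj i w : (u ^+ i) w = 0 -> w = 0.
    elim: i => [|i IHi]; first by rewrite end_one_lfunE.
    by rewrite exprS end_mul_lfunE => /u_inj.
  by apply/eqP/eqP => [/uj_inj //|E]; rewrite E linear0.
apply: (@balanced_blocks (fun j => \dim (lker (n ^+ j))) lam (size f).-1 q r) => //.
- exact: irr_size_gt0 irr_f.
- by move=> j; apply: dim_lker_expS_le.
- by move=> j; apply: dim_lker_exp_concave.
- move=> j; apply: (dvd_dim_stable irr_f fs).
  apply/subvP => _ /memv_imgP[v nv ->]; move: nv; rewrite !memv_ker => /eqP nv.
  have csnj : GRing.comm s (n ^+ j) by apply: commrX.
  by rewrite -end_mul_lfunE -csnj end_mul_lfunE nv linear0.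
- by move=> j; rewrite -!kerE; exact: (dim_ker_step f_monic irr_f lam_gt0 phiX phi_bij).
Qed.

(** * Construction of the nilpotent part *)

Section Sufficiency.

Hypothesis bal : forall t, (lam (t * q) <= 1 + lam (t * q + q.-1))%N.
Variable e : 'I_r -> V.
Hypothesis e_tors : forall i : 'I_r, peval x (f ^+ lam i) (e i) = 0.
Hypothesis e_phi : forall i l : 'I_r, val (phi l (e i)) = (l == i)%:R.
Hypothesis e_gen : forall v, v = \sum_i peval x (val (phi i v)) (e i).
Variable y : {poly K}.
Hypothesis fy : f %| y.

(** Padding the generators by zero lets an incomplete last block be treated like the others. *)
Definition ext_gen l : V := oapp e 0 (insub l).

Lemma ext_genE (i : 'I_r) : ext_gen i = e i.
Proof. by rewrite /ext_gen valK. Qed.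

Lemma ext_gen0 l : (r <= l)%N -> ext_gen l = 0.
Proof. by move=> le_rl; rewrite /ext_gen insubN // -leqNgt. Qed.

(* The image of [ext_gen l] under the nilpotent part to be constructed. *)
Definition shift_gen l : V :=
  if (q %| l.+1)%N then peval x y (ext_gen (l.+1 - q)) else ext_gen l.+1.

Lemma ext_gen_tors l p : f ^+ lam l %| p -> peval x p (ext_gen l) = 0.
Proof.
case/dvdpP => p' ->; rewrite rmorphM /= end_mul_lfunE.
have [le_rl|lt_lr] := leqP r l; first by rewrite ext_gen0 // !linear0.
by rewrite -[l]/(val (Ordinal lt_lr)) ext_genE e_tors linear0.
Qed.

(* Relations between the generators are preserved: this is where [bal] enters. *)
Lemma shift_gen_tors l p : f ^+ lam l %| p -> peval x p (shift_gen l) = 0.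
Proof.
rewrite /shift_gen => lp; case: ifP => [/dvdnP[t Et]|_]; last first.
  by apply: ext_gen_tors; apply: dvdp_trans lp; apply: dvdp_exp2l.
have t_gt0 : (0 < t)%N by case: t Et.
have El : l = (t.-1 * q + q.-1)%N by nia.
have -> : (l.+1 - q = t.-1 * q)%N by nia.
(* At the end of a block, the factor f in y supplies the one extra exponent that the first generator
   may require. *)
rewrite -end_mul_lfunE -rmorphM; apply: ext_gen_tors.
apply: (@dvdp_trans _ (f ^+ (lam l).+1)); first by rewrite dvdp_exp2l // El bal.
by rewrite exprSr dvdp_mul.
Qed.

(** With reduced representatives as coefficients, K-linearity is immediate; compatibility with the
    relations is expressed by [comm_shift]. *)
Definition shift_fun v : V := \sum_(i < r) peval x (val (phi i v)) (shift_gen i).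

Fact shift_fun_linear : linear shift_fun.
Proof.
move=> c u v; rewrite /shift_fun scaler_sumr -big_split /=; apply: eq_bigr => i _.
by rewrite linearP /= rmorphD /= pevalZ add_lfunE scale_lfunE.
Qed.
HB.instance Definition _ := GRing.isSemilinear.Build K V V _ shift_fun
  (GRing.semilinear_linear shift_fun_linear).

Definition shift : 'End(V) := linfun shift_fun.

(** Reducing X times a representative modulo f^(lam i) changes it by a multiple of f^(lam i), which
    kills [shift_gen i]. *)
Lemma comm_shift : GRing.comm x shift.
Proof.
have xE p w : x (peval x p w) = peval x ('X * p) w.
  by rewrite rmorphM /= pevalX end_mul_lfunE.
apply/lfunP => v; rewrite !end_mul_lfunE !lfunE /= /shift_fun linear_sum.
apply: eq_bigr => i _; rewrite phiX.
rewrite -[phi i v in RHS](@in_qpolyK K f (lam i)) -in_qpolyM val_in_qpoly //.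
rewrite /= xE {1}['X * _](divp_eq _ (f ^+ lam i)) rmorphD add_lfunE.
by rewrite /= shift_gen_tors ?add0r // dvdp_mull.
Qed.

Lemma shift_ext_gen l : shift (ext_gen l) = shift_gen l.
Proof.
have [le_rl|lt_lr] := leqP r l.
  (* For l >= r, [lam l] is 0 and the polynomial 1 annihilates [shift_gen l]; at the end of an
     incomplete block this says that y(x) kills the first generator. *)
  rewrite ext_gen0 // linear0 -[RHS]end_one_lfunE -(rmorph1 (peval x)).
  by rewrite shift_gen_tors // lam0 // expr0 dvdpp.
rewrite -[l]/(val (Ordinal lt_lr)); set i := Ordinal _.
rewrite ext_genE lfunE -[LHS]/(shift_fun (e i)) /shift_fun (bigD1 i) // big1.
  by rewrite e_phi eqxx rmorph1 end_one_lfunE /= addr0.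
by move=> j /negPf ji; rewrite e_phi ji rmorph0 zero_lfunE.
Qed.

(** Applying the shift q times goes once around a block and picks up y(x) exactly once. *)
Lemma shift_exp : shift ^+ q = peval x y.
Proof.
have Ek t j : (j < q)%N -> (shift ^+ j) (ext_gen (t * q)) = ext_gen (t * q + j).
  elim: j => [|j IHj] ltj; first by rewrite end_one_lfunE addn0.
  rewrite exprS end_mul_lfunE IHj ?shift_ext_gen; last exact: ltnW.
  rewrite /shift_gen -addnS dvdn_addr ?dvdn_mull // gtnNdvd //.
have Eq t : (shift ^+ q) (ext_gen (t * q)) = peval x y (ext_gen (t * q)).
  rewrite -{1}(prednK q_gt0) exprS end_mul_lfunE Ek ?prednK // shift_ext_gen.
  by rewrite /shift_gen -addnS prednK // dvdn_addr ?dvdn_mull // dvdnn addnK.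
(* Any generator is a shift of the first one in its block, and the shift commutes with y(x). *)
have El l : (shift ^+ q) (ext_gen l) = peval x y (ext_gen l).
  have lt := ltn_pmod l q_gt0.
  rewrite (divn_eq l q) -Ek // -!end_mul_lfunE -exprD addnC exprD.
  rewrite end_mul_lfunE Eq -end_mul_lfunE; congr (fun_of_lfun _ _).
  exact/commr_sym/commrX/comm_peval/comm_shift.
have Ep p (i : 'I_r) : (shift ^+ q) (peval x p (e i)) = peval x y (peval x p (e i)).
  have cp : GRing.comm (peval x p) (shift ^+ q).
    by apply: commrX; apply/comm_peval/comm_shift.
  rewrite -[LHS]end_mul_lfunE -cp end_mul_lfunE -ext_genE El.
  by rewrite -!end_mul_lfunE -!rmorphM mulrC.
by apply/lfunP => v; rewrite [v]e_gen !linear_sum; apply: eq_bigr => i _; apply: Ep.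
Qed.

Lemma shift_JC : f ^+ k %| g \Po ('X^q - y) -> has_Jordan_Chevalley x.
Proof.
move=> fky; have cx := comm_shift.
have cxs : GRing.comm (x - shift) shift.
  apply/commr_sym/commrB; [exact: commr_sym | exact: commr_refl].
exists (x - shift), shift; split=> //; first by rewrite subrK.
  apply: (root_semisimple irr_f).
  have Eq : (x - shift) ^+ q = peval x ('X^q - y).
    rewrite rmorphB rmorphXn /= pevalX -shift_exp; apply/eqP.
    by rewrite eq_sym subr_eq -exprD_pchar_comm // subrK.
  rewrite fE peval_comp rmorphXn /= pevalX Eq -peval_comp.
  by case/dvdpP: fky => h ->; rewrite rmorphM rmorphXn /= fk mulr0.
(* n^(qk) = y(x)^k is a multiple of f(x)^k = 0. *)
exists (q * k)%N; rewrite end_expE exprM shift_exp.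
by case/dvdpP: fy => h ->; rewrite -rmorphXn exprMn rmorphM !rmorphXn /= fk mulr0.
Qed.

End Sufficiency.

Lemma balanced_JC : (forall t, (lam (t * q) <= 1 + lam (t * q + q.-1))%N) ->
  has_Jordan_Chevalley x.
Proof.
move=> bal; have [y [fy fky]] := hensel_root k cop fE.
have [e [e_tors e_phi e_gen]] := exists_generators f_monic irr_f lam_gt0 phiX phi_bij.
exact: (shift_JC bal e_tors e_phi e_gen fy).
Qed.

End Main.

Theorem theoremA
  (K : fieldType) (Kbar : closedFieldType) (iota : {rmorphism K -> Kbar})
  (hKbar : is_algebraic_closure iota)
  (V : vectType K) (x : 'End(V))
  (f : {poly K}) (hf_monic : f \is monic) (hf_irr : irreducible_poly f)
  (q : nat) (hq_pos : (0 < q)%N) (hq : is_insep_degree iota f q)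
  (hx : primary f x)
  (inv : nat -> nat) (hinv : is_inv f x inv) :
  has_Jordan_Chevalley x <->
  (forall i : nat, (0 < i)%N ->
     (inv ((i - 1) * q + 1) <= 1 + inv (i * q))%N).
Proof.
have [g [fE cop qK]] := insep_decomp hf_irr hq.
have [k [_ fk0 _]] := hx.
have fk : peval x f ^+ k = 0 by rewrite -rmorphXn /= -end_hornerE.
have [r [inv_dec inv_pos [phi [phiX phi_bij]]]] := hinv.
(* Counting from 0 turns the indices (i-1)q + 1 and iq into the first and last of the block tq, ...,
   tq + q - 1, with t = i - 1. *)
pose lam i := inv i.+1.
have lam_gt0 (i : 'I_r) : (0 < lam i)%N by rewrite inv_pos.
have lamS i : (lam i.+1 <= lam i)%N by apply: inv_dec.
have lam0 i : (r <= i)%N -> lam i = 0.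
  by move=> le_ri; apply/eqP; rewrite -leqn0 leqNgt inv_pos // -leqNgt.
have indexE t : (inv ((t.+1 - 1) * q + 1) <= 1 + inv (t.+1 * q))%N =
    (lam (t * q) <= 1 + lam (t * q + q.-1))%N.
  have -> : (t.+1 * q = (t * q + q.-1).+1)%N by rewrite -addnS prednK // mulSn addnC.
  by rewrite subn1 addn1.
split=> [JC [//|t] _|bal].
  rewrite indexE.
  exact: (JC_balanced hf_monic hf_irr lam_gt0 phiX phi_bij lamS lam0 hq_pos fE cop qK fk).
apply: (balanced_JC hf_monic hf_irr lam_gt0 phiX phi_bij lamS lam0 hq_pos fE cop qK fk).
by move=> t; rewrite -indexE; apply: bal.
Qed.
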